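(* Let $(M,\boldsymbol\eta)$ be a co-oriented $k$-contact manifold and let $X_1,\dots,X_k$ be $\boldsymbol\eta$-Hamiltonian vector fields on $M$. Then $(X_1,\dots,X_k)$ is an $\boldsymbol\eta$-Hamiltonian $k$-vector field.
   Context: Manifolds are smooth, Hausdorff, connected and finite-dimensional; all structures are smooth. $\{e_1,\dots,e_k\}$ is a basis of $\mathbb{R}^k$. **Co-oriented $k$-contact manifold.** A pair $(M,\boldsymbol\eta)$, where $\boldsymbol\eta=\sum_{\alpha=1}^k\eta^\alpha\otimes e_\alpha\in\Omega^1(M,\mathbb{R}^k)$ is a $k$-contact form on $M$, i.e. (1) $\ker\boldsymbol\eta=\bigcap_\alpha\ker\eta^\alpha\subset TM$ is a regular non-zero distribution of corank $k$; (2) $\ker d\boldsymbol\eta=\bigcap_\alpha\ker d\eta^\alpha\subset TM$ is a regular distribution of rank $k$; (3) $\ker\boldsymbol\eta\cap\ker d\boldsymbol\eta=0$. There exist unique vector fields $R_1,\dots,R_k$ on $M$ (the Reeb vector fields) with $\iota_{R_\alpha}\eta^\beta=\delta_\alpha^\beta$ and $\iota_{R_\alpha}d\eta^\beta=0$ for $\alpha,\beta=1,\dots,k$. **$\boldsymbol\eta$-Hamiltonian vector field.** A vector field $X$ on $M$ such that $[X,Z]$ takes values in $\ker\boldsymbol\eta$ for every vector field $Z$ taking values in $\ker\boldsymbol\eta$. Equivalently, there is $\boldsymbol h=\sum_\alpha h^\alpha e_\alpha\in C^\infty(M,\mathbb{R}^k)$ with $\iota_X\eta^\alpha=-h^\alpha$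 and $\iota_Xd\eta^\alpha=dh^\alpha-\sum_{\beta=1}^k(R_\beta h^\alpha)\eta^\beta$ for $\alpha=1,\dots,k$. **$\boldsymbol\eta$-Hamiltonian $k$-vector field.** A $k$-vector field on $M$ is a $k$-tuple $(X_1,\dots,X_k)$ of vector fields on $M$ (a section of $\bigoplus^kTM\to M$). It is called $\boldsymbol\eta$-Hamiltonian if there is a function $h\in C^\infty(M)$ such that $$\sum_{\alpha=1}^k\iota_{X_\alpha}d\eta^\alpha=dh-\sum_{\alpha=1}^k(R_\alpha h)\eta^\alpha,\qquad \sum_{\alpha=1}^k\iota_{X_\alpha}\eta^\alpha=-h.$$ *)

(* Defs.v *)
From HB Require Import structures.
From mathcomp Require Import all_boot all_order all_algebra.
From mathcomp Require Import boolp classical_sets functions reals.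
From mathcomp Require Import topology normedtype derive.
From mathcomp Require Import ring.

Set Implicit Arguments.
Unset Strict Implicit.
Unset Printing Implicit Defensive.

Import Order.TTheory GRing.Theory Num.Theory.
Import numFieldNormedType.Exports.

Local Open Scope classical_set_scope.
Local Open Scope ring_scope.

(* Only meant for open U, so that continuity and differentiability at the
   points of U do not depend on the values of f outside U. *)
Fixpoint Cr_on (R : realType) (n r : nat) (U : set 'rV[R]_n)
    (f : 'rV[R]_n -> R) : Prop :=
  (forall x, U x -> {for x, continuous f}) /\
  if r is r'.+1 then
    forall i : 'I_n, (forall x, U x -> derivable f x 'e_i) /\
                     Cr_on r' U (fun x => 'D_('e_i) f x)
  else True.

Definition smooth_on (R : realType) (n : nat) (U : set 'rV[R]_n)
    (f : 'rV[R]_n -> R) : Prop :=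
  forall r, Cr_on r U f.

Section calculus.
Context {R : realType} {n : nat}.
Implicit Types (U : set 'rV[R]_n) (f g : 'rV[R]_n -> R).

Lemma Cr_on_cont r U f : Cr_on r U f -> forall x, U x -> {for x, continuous f}.
Proof. by case: r => [|r] []. Qed.

Lemma Cr_onW r U f : Cr_on r.+1 U f -> Cr_on r U f.
Proof.
elim: r f => [|r IH] f [fc fd]; split=> // i.
by have [? ?] := fd i; split=> //; exact: IH.
Qed.

Lemma Cr_on_eq r U f g : open U -> (forall x, U x -> f x = g x) ->
  Cr_on r U f -> Cr_on r U g.
Proof.
move=> Uo; elim: r f g => [|r IH] f g fg fr;
  have fgx x : U x -> \forall y \near x, f y = g y by
    move=> Ux; apply: filterS fg _; exact: open_nbhs_nbhs.
all: have gc x : U x -> {for x, continuous g} by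
  move=> Ux; rewrite /prop_for /continuous_at -(fg _ Ux);
  exact: cvg_trans (near_eq_cvg (fgx _ Ux)) (Cr_on_cont fr Ux).
  by split.
split=> [//|i]; have [fdi fD] := fr.2 i; split=> [x Ux|].
  exact: near_eq_derivable (fgx _ Ux) (fdi _ Ux).
apply: IH fD => x Ux; exact: near_eq_derive (fgx _ Ux).
Qed.

Lemma Cr_on_cst r U (a : R) : open U -> Cr_on r U (cst a).
Proof.
move=> Uo; elim: r a => [|r IH] a.
  by split=> // x _; exact: cst_continuous.
split=> [x _|i]; first exact: cst_continuous.
split=> [x _|]; first exact: derivable_cst.
by apply: Cr_on_eq (IH 0) => // x _; rewrite derive_cst.
Qed.

Lemma Cr_on_add r U f g : open U -> Cr_on r U f -> Cr_on r U g ->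
  Cr_on r U (f + g).
Proof.
move=> Uo; elim: r f g => [|r IH] f g fr gr;
  have fgc x : U x -> {for x, continuous (f + g)} by
    move=> Ux; exact: continuousD (Cr_on_cont fr Ux) (Cr_on_cont gr Ux).
  by split.
split=> [//|i]; have [fdi fD] := fr.2 i; have [gdi gD] := gr.2 i.
split=> [x Ux|]; first exact: derivableD (fdi _ Ux) (gdi _ Ux).
apply: Cr_on_eq (IH _ _ fD gD) => // x Ux.
by rewrite deriveD; [|exact: fdi|exact: gdi].
Qed.

Lemma Cr_on_mul r U f g : open U -> Cr_on r U f -> Cr_on r U g ->
  Cr_on r U (f * g).
Proof.
move=> Uo; elim: r f g => [|r IH] f g fr gr;
  have fgc x : U x -> {for x, continuous (f * g)} by
    move=> Ux; exact: continuousM (Cr_on_cont fr Ux) (Cr_on_cont gr Ux).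
  by split.
split=> [//|i]; have [fdi fD] := fr.2 i; have [gdi gD] := gr.2 i.
split=> [x Ux|]; first exact: derivableM (fdi _ Ux) (gdi _ Ux).
apply: Cr_on_eq (Cr_on_add Uo (IH _ _ (Cr_onW fr) gD)
                              (IH _ _ (Cr_onW gr) fD)) => // x Ux.
by rewrite deriveM; [|exact: fdi|exact: gdi].
Qed.

End calculus.

Record chart (R : realType) (n : nat) (M : topologicalType) := Chart {
  chart_dom : set M;
  chart_map : M -> 'rV[R]_n;
  chart_inv : 'rV[R]_n -> M }.

Definition chart_cod (R : realType) (n : nat) (M : topologicalType)
    (c : chart R n M) : set 'rV[R]_n := chart_map c @` chart_dom c.

Definition is_chart (R : realType) (n : nat) (M : topologicalType)
    (c : chart R n M) : Prop :=
  [/\ open (chart_dom c), open (chart_cod c),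
      forall p, chart_dom c p -> chart_inv c (chart_map c p) = p,
      forall p, chart_dom c p -> {for p, continuous (chart_map c)} &
      forall u, chart_cod c u -> {for u, continuous (chart_inv c)}].

Definition compatible_charts (R : realType) (n : nat) (M : topologicalType)
    (c d : chart R n M) : Prop :=
  forall j : 'I_n,
    smooth_on (chart_map c @` (chart_dom c `&` chart_dom d))
              (fun u => chart_map d (chart_inv c u) 0 j).

(* The atlas need not be maximal; second countability is not required. *)
Record manifold (R : realType) (n : nat) := Manifold {
  points :> topologicalType;
  atlas : set (chart R n points);
  manifold_hausdorff : hausdorff_space points;
  manifold_connected : connected [set: points];
  atlas_chart : forall c, atlas c -> is_chart c;
  atlas_cover : forall p, exists2 c, atlas c & chart_dom c p;
  atlas_compatible : forall c d, atlas c -> atlas d -> compatible_charts c d }.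

Definition is_smooth (R : realType) (n : nat) (M : manifold R n)
    (f : M -> R) : Prop :=
  forall c, atlas c -> smooth_on (chart_cod c) (f \o chart_inv c).

Definition smooth_pred (R : realType) (n : nat) (M : manifold R n) :
  {pred (M -> R)} := [pred f | `[< is_smooth f >]].
Arguments smooth_pred {R n} M.

Record smoothfun (R : realType) (n : nat) (M : manifold R n) := SmoothFun {
  smoothfun_fun :> M -> R;
  smoothfunP : smoothfun_fun \in smooth_pred M }.

Section smoothfun_algebra.
Context (R : realType) (n : nat) (M : manifold R n).

Let cod_open (c : chart R n M) : atlas c -> open (chart_cod c).
Proof. by move=> /atlas_chart[]. Qed.

Lemma smooth_cst (a : R) : cst a \in smooth_pred M.
Proof. by apply/asboolP => c /cod_open Uo r; exact: Cr_on_cst. Qed.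

Lemma smoothD (f g : M -> R) :
  f \in smooth_pred M -> g \in smooth_pred M -> f + g \in smooth_pred M.
Proof.
move=> /asboolP fs /asboolP gs; apply/asboolP => c cA r.
by apply: (Cr_on_add (cod_open cA)); [exact: fs|exact: gs].
Qed.

Lemma smoothM (f g : M -> R) :
  f \in smooth_pred M -> g \in smooth_pred M -> f * g \in smooth_pred M.
Proof.
move=> /asboolP fs /asboolP gs; apply/asboolP => c cA r.
by apply: (Cr_on_mul (cod_open cA)); [exact: fs|exact: gs].
Qed.

Lemma smooth_subring_closed : subring_closed (smooth_pred M).
Proof.
split=> [|f g fs gs|]; [exact: smooth_cst| |exact: smoothM].
have -> : f - g = f + cst (-1) * g.
  by apply/funext => x; rewrite !fctE mulN1r.
by apply: smoothD => //; apply: smoothM => //; exact: smooth_cst.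
Qed.

HB.instance Definition _ :=
  GRing.isSubringClosed.Build (M -> R) (smooth_pred M) smooth_subring_closed.

Lemma smooth_scaler_closed : GRing.scaler_closed (smooth_pred M).
Proof.
move=> a f fs; have -> : a *: f = cst a * f by [].
by apply: smoothM => //; exact: smooth_cst.
Qed.

HB.instance Definition _ :=
  GRing.isScaleClosed.Build R (M -> R) (smooth_pred M) smooth_scaler_closed.

HB.instance Definition _ := [isSub for (@smoothfun_fun R n M)].
HB.instance Definition _ := [Choice of smoothfun M by <:].
HB.instance Definition _ :=
  GRing.SubChoice_isSubComPzRing.Build _ _ (smoothfun M) smooth_subring_closed.
HB.instance Definition _ := [SubZmodule_isSubLmodule of smoothfun M by <:].

End smoothfun_algebra.

Section tensors.
Context {R : realType} {n : nat} {M : manifold R n}.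
Local Notation C := (smoothfun M).

(* The tangent space at p: the derivations at p of the algebra C. *)
Definition tangent (p : M) : set (C -> R) :=
  [set v | scalar v /\ forall f g : C, v (f * g) = f p * v g + g p * v f].

Record vfield := VField {
  vfield_at :> M -> C -> R;
  vfield_tangent : forall p, tangent p (vfield_at p);
  vfield_smooth : forall f, (fun p => vfield_at p f) \in smooth_pred M }.

Definition lied (X : vfield) (f : C) : C := SmoothFun (vfield_smooth X f).

Lemma lied_linear (X : vfield) : linear (lied X).
Proof.
move=> a f g; apply: val_inj; apply/funext => p /=.
by case: (vfield_tangent X p) => -> _.
Qed.

Lemma liedM (X : vfield) (f g : C) :
  lied X (f * g) = f * lied X g + g * lied X f.
Proof.
apply: val_inj; apply/funext => p /=.
by case: (vfield_tangent X p) => _ ->.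
Qed.

Definition lie_at (X Y : vfield) (p : M) (f : C) : R :=
  X p (lied Y f) - Y p (lied X f).

Lemma lie_tangent (X Y : vfield) (p : M) : tangent p (lie_at X Y p).
Proof.
have [Xl XL] := vfield_tangent X p; have [Yl YL] := vfield_tangent Y p.
have XD f g : X p (f + g) = X p f + X p g.
  by rewrite -[f]scale1r Xl mul1r scale1r.
have YD f g : Y p (f + g) = Y p f + Y p g.
  by rewrite -[f]scale1r Yl mul1r scale1r.
split=> [a f g|f g]; rewrite /lie_at.
  by rewrite !lied_linear Xl Yl opprD mulrBr addrACA.
by rewrite !liedM XD YD !XL !YL /=; ring.
Qed.

Lemma lie_smooth (X Y : vfield) (f : C) :
  (fun p => lie_at X Y p f) \in smooth_pred M.
Proof. exact: valP (lied X (lied Y f) - lied Y (lied X f)). Qed.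

Definition lie (X Y : vfield) : vfield :=
  VField (lie_tangent X Y) (lie_smooth X Y).

(* A 1-form is a smooth family of covectors; the values of [form_at p] outside
   [tangent p] are irrelevant. *)
Record form1 := Form1 {
  form_at :> M -> (C -> R) -> R;
  form_linear : forall p (a : R) v w, tangent p v -> tangent p w ->
    form_at p (a *: v + w) = a * form_at p v + form_at p w;
  form_smooth : forall X : vfield, (fun p => form_at p (X p)) \in smooth_pred M }.

Definition contract (X : vfield) (eta : form1) : C :=
  SmoothFun (form_smooth eta X).

(* The exterior derivative d eta, as a C-bilinear form on vector fields, by
   Cartan's invariant formula (with no factor 1/2). *)
Definition dform (eta : form1) (X Y : vfield) : C :=
  lied X (contract Y eta) - lied Y (contract X eta) - contract (lie X Y) eta.

(* S is a linear subspace of V with a basis of r vectors. *)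
Definition has_dim (V : lmodType R) (S : set V) (r : nat) : Prop :=
  exists b : 'I_r -> V,
    (forall a : 'I_r -> R, \sum_i a i *: b i = 0 -> forall i, a i = 0) /\
    S = [set v | exists a : 'I_r -> R, v = \sum_i a i *: b i].

Definition takes_values (D : M -> set (C -> R)) (X : vfield) : Prop :=
  forall p, D p (X p).

(* Constant rank r, and smooth: spanned by the vector fields with values in D.
   (Extending local sections by bump functions, global ones suffice.) *)
Definition regular_distribution (D : M -> set (C -> R)) (r : nat) : Prop :=
  (forall p, D p `<=` tangent p /\ has_dim (D p) r) /\
  (forall p v, D p v -> exists2 X : vfield, takes_values D X & X p = v).

Section kcontact.
Context {k : nat}.
Implicit Type eta : 'I_k -> form1.

Definition ker_form eta (p : M) : set (C -> R) :=
  [set v | tangent p v /\ forall alpha, eta alpha p v = 0].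

(* By tensoriality, (d eta)_p (v, -) is computed from any vector field X
   extending v. *)
Definition ker_dform eta (p : M) : set (C -> R) :=
  [set v | tangent p v /\ exists2 X : vfield, X p = v &
           forall alpha (Y : vfield), dform (eta alpha) X Y p = 0].

Definition kcontact_form eta : Prop :=
  [/\ exists2 r, (0 < r)%N /\ (r + k = n)%N &
         regular_distribution (ker_form eta) r,
      regular_distribution (ker_dform eta) k &
      forall p, ker_form eta p `&` ker_dform eta p = [set 0]].

Definition reeb eta (Rb : 'I_k -> vfield) : Prop :=
  forall alpha beta,
    contract (Rb alpha) (eta beta) = (alpha == beta)%:R /\
    forall Y : vfield, dform (eta beta) (Rb alpha) Y = 0.

Definition hamiltonian_vfield eta (X : vfield) : Prop :=
  forall Z : vfield, takes_values (ker_form eta) Z ->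
    takes_values (ker_form eta) (lie X Z).

(* The equality of 1-forms is tested on all vector fields Y. *)
Definition hamiltonian_kvfield eta (Rb : 'I_k -> vfield)
    (X : 'I_k -> vfield) : Prop :=
  exists h : C,
    (forall Y : vfield,
       \sum_alpha dform (eta alpha) (X alpha) Y =
       lied Y h - \sum_alpha lied (Rb alpha) h * contract Y (eta alpha)) /\
    \sum_alpha contract (X alpha) (eta alpha) = - h.

End kcontact.
End tensors.

Arguments vfield {R n} M.
Arguments form1 {R n} M.

(* Main.v *)
(* For an eta-Hamiltonian vector field X put h = - eta^b(X). Any vector field
    Y differs from a section Z of ker eta by the combination of the Reeb fields
    R_c with coefficients eta^c(Y). Expanding [X, Z], on which eta^b vanishes,
    gives
      eta^b([X, Y]) = X(eta^b(Y)) + sum_c eta^c(Y) eta^b([X, R_c]),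
    and d eta^b (R_c, X) = 0 gives eta^b([X, R_c]) = R_c h. Cartan's formula for
    d eta^b (X, Y) is then the Hamiltonian equation of X, for every component b.
    The k-vector field equation is the sum over a of the a-th such equation
    for X_a, with h the sum of the - eta^a(X_a). *)
Require Import Defs.
From mathcomp Require Import all_boot all_order all_algebra.
From mathcomp Require Import boolp functions reals topology normedtype ring.

Set Implicit Arguments.
Unset Strict Implicit.
Unset Printing Implicit Defensive.

Import GRing.Theory numFieldNormedType.Exports.
Local Open Scope ring_scope.

Section tensors.
Context {R : realType} {n : nat} {M : manifold R n}.
Local Notation C := (smoothfun M).
Implicit Types (p : M) (v w : C -> R) (X Y : vfield M) (f g : C).

Lemma smoothfun_eq f g : (forall p, f p = g p) -> f = g.
Proof. by move=> fg; apply: val_inj; apply/funext. Qed.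

Lemma smoothfun_sumE I (r : seq I) (F : I -> C) p :
  (\sum_(i <- r) F i) p = \sum_(i <- r) F i p.
Proof. by elim/big_rec2: _ => // i x g _ <-. Qed.

Lemma smoothfunBE f g p : (f - g) p = f p - g p.
Proof. by []. Qed.

Lemma comb_sumE I (r : seq I) (a : I -> R) (v : I -> C -> R) f :
  (\sum_(i <- r) a i *: v i) f = \sum_(i <- r) a i * v i f.
Proof. by rewrite fct_sumE. Qed.

Lemma tangent0 p : tangent p 0.
Proof. by split=> [a f g|f g]; rewrite /= !mulr0 addr0. Qed.

Lemma comb_funE (a : R) v w f : (a *: v + w) f = a * v f + w f.
Proof. by []. Qed.

Lemma tangent_linear p (a : R) v w :
  tangent p v -> tangent p w -> tangent p (a *: v + w).
Proof.
move=> [vl vM] [wl wM]; split=> [b f g|f g]; rewrite !comb_funE.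
  by rewrite vl wl /=; ring.
by rewrite vM wM; ring.
Qed.

Lemma tangent_sum p I (r : seq I) (a : I -> R) (v : I -> C -> R) :
  (forall i, tangent p (v i)) -> tangent p (\sum_(i <- r) a i *: v i).
Proof.
move=> vt; elim/big_rec: _ => [|i w _ wt]; first exact: tangent0.
exact: tangent_linear.
Qed.

Lemma form0 (eta : form1 M) p : eta p 0 = 0.
Proof.
have := form_linear eta (-1) (tangent0 p) (tangent0 p).
by rewrite scaler0 addr0 mulN1r addNr.
Qed.

Lemma form_sum (eta : form1 M) p I (r : seq I) (a : I -> R) (v : I -> C -> R) :
  (forall i, tangent p (v i)) ->
  eta p (\sum_(i <- r) a i *: v i) = \sum_(i <- r) a i * eta p (v i).
Proof.
move=> vt; elim: r => [|i r IH]; first by rewrite !big_nil form0.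
by rewrite !big_cons form_linear // ?IH //; exact: tangent_sum.
Qed.

Lemma formB (eta : form1 M) p v w : tangent p v -> tangent p w ->
  eta p (v - w) = eta p v - eta p w.
Proof. by move=> vt wt; rewrite addrC -scaleN1r form_linear //; ring. Qed.

Lemma tangentD_fun p v f g : tangent p v -> v (f + g) = v f + v g.
Proof. by case=> vl _; rewrite -[f]scale1r vl mul1r scale1r. Qed.

Lemma tangent_fun0 p v : tangent p v -> v 0 = 0.
Proof. by case=> vl _; have := vl (-1) 0 0; rewrite scaler0 addr0 mulN1r addNr. Qed.

Lemma tangentN_fun p v f : tangent p v -> v (- f) = - v f.
Proof.
by move=> vt; apply/eqP; rewrite -addr_eq0 -(tangentD_fun _ _ vt) addNr (tangent_fun0 vt).
Qed.

Lemma tangent_sum_fun p v I (r : seq I) (F : I -> C) :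
  tangent p v -> v (\sum_(i <- r) F i) = \sum_(i <- r) v (F i).
Proof.
move=> vt; elim: r => [|i r IH]; first by rewrite !big_nil (tangent_fun0 vt).
by rewrite !big_cons (tangentD_fun _ _ vt) IH.
Qed.

(** The Leibniz rule for 1 * 1 gives v(1) = v(1) + v(1). Hence derivations kill the constant
    functions eta^beta(R_c). *)
Lemma tangent_fun1 p v : tangent p v -> v 1 = 0.
Proof.
case=> _ vM; have := vM 1 1; rewrite mulr1 /= mul1r => /eqP.
by rewrite -subr_eq0 opprD addrA subrr sub0r oppr_eq0 => /eqP.
Qed.

Section subtract_comb.
Context {k : nat} (Y : vfield M) (c : 'I_k -> C) (V : 'I_k -> vfield M).

(** Meant for V the Reeb fields and c the functions eta^i(Y): the difference is then the projection
    of Y to ker eta along the Reeb directions. *)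
Let Z p : C -> R := Y p - \sum_i c i p *: V i p.

Lemma vsub_comb_tangent p : tangent p (Z p).
Proof.
rewrite /Z addrC -scaleN1r; apply: tangent_linear (vfield_tangent Y p).
by apply: tangent_sum => i; exact: vfield_tangent.
Qed.

Lemma vsub_combE p f : Z p f = Y p f - \sum_i c i p * V i p f.
Proof. by rewrite /Z !fctE comb_sumE. Qed.

Lemma vsub_comb_smooth f : (fun p => Z p f) \in smooth_pred M.
Proof.
have -> : (fun p => Z p f) = smoothfun_fun (lied Y f - \sum_i c i * lied (V i) f).
  by apply/funext => p; rewrite vsub_combE smoothfunBE smoothfun_sumE.
exact: smoothfunP.
Qed.

Definition vsub_comb : vfield M := VField vsub_comb_tangent vsub_comb_smooth.

Lemma lied_vsub_comb f :
  lied vsub_comb f = lied Y f - \sum_i c i * lied (V i) f.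
Proof. by apply: smoothfun_eq => p; rewrite smoothfunBE smoothfun_sumE /= vsub_combE. Qed.

(** This is [X, c V] = X(c) V + c [X, V], summed over the combination. *)
Lemma lie_vsub_comb X p :
  lie X vsub_comb p = lie X Y p -
    (\sum_i X p (c i) *: V i p + \sum_i c i p *: lie X (V i) p).
Proof.
apply/funext => f; have Xt := vfield_tangent X p.
rewrite !fctE !comb_sumE /= /lie_at lied_vsub_comb (tangentD_fun _ _ Xt).
rewrite (tangentN_fun _ Xt) (tangent_sum_fun _ _ Xt) /= vsub_combE.
(* The terms c_i V_i(X f) are added and subtracted to complete the brackets [X, V_i]; the surplus
   sum cancels the one coming from the derivative of X f along the combination. *)
have -> : \sum_i X p (c i * lied (V i) f) =
    \sum_i X p (c i) * V i p f +
    \sum_i c i p * (X p (lied (V i) f) - V i p (lied X f)) +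
    \sum_i c i p * V i p (lied X f).
  rewrite -!big_split /=; apply: eq_bigr => i _.
  by case: Xt => _ -> /=; ring.
rewrite /lie_at; ring.
Qed.

End subtract_comb.

Lemma hamiltonian_vfieldE k (eta : 'I_k -> form1 M) (Rb : 'I_k -> vfield M) X :
  reeb eta Rb -> hamiltonian_vfield eta X ->
  forall beta Y, dform (eta beta) X Y =
    lied Y (- contract X (eta beta)) -
    \sum_c lied (Rb c) (- contract X (eta beta)) * contract Y (eta c).
Proof.
move=> reebR hamX beta Y.
pose Z := vsub_comb Y (fun c => contract Y (eta c)) Rb.
have Rb_eta c b p : eta b p (Rb c p) = (c == b)%:R.
  have /(congr1 (fun f : C => f p)) /= -> := (reebR c b).1.
  by case: (c == b).
(* Since eta^b(R_c) is the Kronecker delta, only c = b survives and eta^b(Z) = eta^b(Y) -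
   eta^b(Y). *)
have Zker : takes_values (ker_form eta) Z.
  move=> p; split=> [|b]; first exact: vfield_tangent.
  rewrite /= formB; [|exact: vfield_tangent|]; last first.
    by apply: tangent_sum => c; exact: vfield_tangent.
  rewrite form_sum => [|c]; last exact: vfield_tangent.
  rewrite (bigD1 b) //= big1 => [|c cb]; last by rewrite Rb_eta (negPf cb) mulr0.
  by rewrite Rb_eta eqxx mulr1 addr0 subrr.
apply: smoothfun_eq => p; have Xt := vfield_tangent X p.
(* In Cartan's formula for d eta^beta(R_c, X) = 0 the term X(eta^beta(R_c)) vanishes, the function
   being constant; antisymmetry of the bracket does the rest. *)
have lieXR c : eta beta p (lie X (Rb c) p) =
    Rb c p (- contract X (eta beta)).
  have := (reebR c beta).2 X; rewrite /dform (reebR c beta).1.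
  move=> /(congr1 (fun f : C => f p)); rewrite !smoothfunBE /=.
  have -> : X p (c == beta)%:R = 0.
    by case: (c == beta); [exact: tangent_fun1 Xt|exact: tangent_fun0 Xt].
  have -> : lie_at (Rb c) X p = 0 - (lie X (Rb c) p : C -> R).
    by apply/funext => f; rewrite sub0r /= !fctE /lie_at opprB.
  rewrite formB; [|exact: tangent0|exact: vfield_tangent].
  rewrite form0 (tangentN_fun _ (vfield_tangent _ _)) sub0r subr0 opprK => /eqP.
  by rewrite addrC addr_eq0 => /eqP.
have lieXY : eta beta p (lie X Y p) = X p (contract Y (eta beta)) +
    \sum_c contract Y (eta c) p * eta beta p (lie X (Rb c) p).
  have S1t : tangent p (\sum_c X p (contract Y (eta c)) *: Rb c p).
    by apply: tangent_sum => c; exact: vfield_tangent.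
  have S2t : tangent p (\sum_c contract Y (eta c) p *: lie X (Rb c) p).
    by apply: tangent_sum => c; exact: vfield_tangent.
  have S12t := tangent_linear 1 S1t S2t; rewrite scale1r in S12t.
  (* Here eta^beta([X, Z]) = 0 is expanded. Among the terms X(eta^c(Y)) eta^beta(R_c) only c = beta
     remains, which leaves X(eta^beta(Y)). *)
  have [_ /(_ beta)] := hamX _ Zker p.
  rewrite lie_vsub_comb formB //; last exact: vfield_tangent.
  rewrite -[in X in _ - X](scale1r (\sum_c X p _ *: _)) form_linear // mul1r.
  rewrite !form_sum; [|by move=> c; exact: vfield_tangent..].
  rewrite (bigD1 beta) //= big1 => [|c cb].
    by rewrite Rb_eta eqxx mulr1 addr0 => /eqP; rewrite subr_eq0 => /eqP.
  by rewrite Rb_eta (negPf cb) mulr0.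
(* After [lieXY] the two terms X(eta^beta(Y)) cancel in Cartan's formula, and [lieXR] identifies the
   remaining sum. *)
rewrite /dform !smoothfunBE smoothfun_sumE /= (tangentN_fun _ (vfield_tangent Y p)).
rewrite [eta beta p _]lieXY.
have -> : \sum_c contract Y (eta c) p * eta beta p (lie X (Rb c) p) =
    \sum_c Rb c p (- contract X (eta beta)) * eta c p (Y p).
  by apply: eq_bigr => c _; rewrite lieXR mulrC.
ring.
Qed.

End tensors.

Theorem theorem11p9 (R : realType) (n k : nat) (M : manifold R n)
    (eta : 'I_k -> form1 M) (Rb : 'I_k -> vfield M) (X : 'I_k -> vfield M) :
  kcontact_form eta ->
  reeb eta Rb ->
  (forall alpha, hamiltonian_vfield eta (X alpha)) ->
  hamiltonian_kvfield eta Rb X.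
Proof.
move=> _ reebR hamX.
exists (\sum_a - contract (X a) (eta a)); split=> [Y|]; last first.
  by rewrite sumrN opprK.
have lied_sum (V : vfield M) (F : 'I_k -> smoothfun M) :
    lied V (\sum_a F a) = \sum_a lied V (F a).
  apply: smoothfun_eq => p.
  by rewrite smoothfun_sumE /= (tangent_sum_fun _ _ (vfield_tangent V p)).
under eq_bigr do rewrite (hamiltonian_vfieldE reebR (hamX _)).
(* With c outermost, eta^c(Y) is a common factor of the sum over a, and the derivatives R_c h^a add
   up to R_c h. *)
rewrite sumrB lied_sum exchange_big /=; congr (_ - _).
by apply: eq_bigr => c _; rewrite lied_sum mulr_suml.
Qed.
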